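(* There is a constant $C>0$ such that for every integer $t\ge 2$, every finite graph $G$ with no $K_t$-minor satisfies $\mathrm{box}(G)\le C t^2\log t$.
   Context: Graphs are finite and simple. The intersection of graphs $G_1,\dots,G_k$ on a common vertex set $V$ is the graph on $V$ whose edge set is the intersection of their edge sets. The boxicity $\mathrm{box}(G)$ of a graph $G$ is the smallest integer $k$ such that $G$ is the intersection of $k$ interval graphs on $V(G)$. *)

(* Defs.v *)
From mathcomp Require Import all_boot all_order all_algebra.

Set Implicit Arguments.
Unset Strict Implicit.
Unset Printing Implicit Defensive.

Import Order.TTheory GRing.Theory Num.Theory.

Record sgraph (V : finType) := SGraph {
  adj :> rel V;
  adj_sym : symmetric adj;
  adj_irrefl : irreflexive adj }.

Lemma neq_sym (V : finType) : symmetric [rel u v : V | u != v].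
Proof. by move=> u v /=; rewrite eq_sym. Qed.

Lemma neq_irrefl (V : finType) : irreflexive [rel u v : V | u != v].
Proof. by move=> u /=; rewrite eqxx. Qed.

Definition complete_graph (t : nat) : sgraph 'I_t :=
  SGraph (@neq_sym 'I_t) (@neq_irrefl 'I_t).

(* [set0] satisfies this; non-emptiness is imposed separately in [minor]. *)
Definition connected_in (V : finType) (G : sgraph V) (B : {set V}) : Prop :=
  {in B &, forall x y, connect [rel u v in B | G u v] x y}.

(* Branch-set model: contracting each [B x] and deleting the superfluous
   vertices and edges turns [G] into [H]. *)
Definition minor (W V : finType) (H : sgraph W) (G : sgraph V) : Prop :=
  exists B : W -> {set V},
    [/\ forall x, B x != set0,
        forall x, connected_in G (B x),
        forall x y, x != y -> [disjoint B x & B y]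
      & forall x y, H x y -> exists u v, [/\ u \in B x, v \in B y & G u v]].

(* Imported only here because the classical-set notations shadow the finite-set
   ones used above. *)
From mathcomp Require Import all_classical all_reals all_analysis.
Local Open Scope classical_set_scope.
Local Open Scope ring_scope.

Definition interval_graph (R : realType) (V : finType) (G : sgraph V) : Prop :=
  exists a b : V -> R,
    (forall v, a v <= b v) /\
    forall u v, u != v ->
      (G u v <-> `[a u, b u]%classic `&` `[a v, b v]%classic !=set0).

(* The condition [u != v] matters only for [k = 0]: the empty intersection is
   the complete graph on [V], so complete graphs have boxicity 0. *)
Definition interval_intersection (R : realType) (V : finType) (G : sgraph V)
    (k : nat) : Prop :=
  exists H : 'I_k -> sgraph V,
    (forall i, interval_graph R (H i)) /\
    forall u v, u != v -> (G u v <-> forall i, H i u v).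

(* Removing one pair [p] of vertices from the complete graph leaves an interval
   graph, and every graph is the intersection of such graphs. *)
Definition copair_rel (V : finType) (p : V * V) : rel V :=
  [rel u v | [&& u != v, (u, v) != p & (v, u) != p]].

Lemma copair_sym (V : finType) (p : V * V) : symmetric (copair_rel p).
Proof. by move=> u v; rewrite /copair_rel /= eq_sym [X in _ && X]andbC. Qed.

Lemma copair_irrefl (V : finType) (p : V * V) : irreflexive (copair_rel p).
Proof. by move=> u; rewrite /copair_rel /= eqxx. Qed.

Definition copair_graph (V : finType) (p : V * V) : sgraph V :=
  SGraph (copair_sym p) (copair_irrefl p).

Lemma copair_interval (R : realType) (V : finType) (p : V * V) :
  p.1 != p.2 -> interval_graph R (copair_graph p).
Proof.
case: p => x y /= nxy.
exists (fun v => if v == y then 1 else 0), (fun v => if v == x then 0 else 1).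
split=> [v|u v nuv].
  by case: (eqVneq v y) => [->|_]; [rewrite eq_sym (negbTE nxy)|case: ifP].
rewrite /copair_graph /copair_rel /= !xpair_eqE nuv /=; split.
- move=> /andP[h1 h2].
  exists (if (u == y) || (v == y) then 1 else 0) => /=.
  rewrite !in_itv /=; move: nxy nuv h1 h2.
  case: (eqVneq u y) => ?; case: (eqVneq v y) => ?;
    case: (eqVneq u x) => ?; case: (eqVneq v x) => ? //=; subst;
    by rewrite ?eqxx ?lexx ?ler01.
- case=> z /=; rewrite !in_itv /= => -[/andP[a1 b1] /andP[a2 b2]].
  apply/andP; split; apply/negP => /andP[/eqP eu /eqP ev]; subst.
  + by move: (le_trans a2 b1); rewrite !eqxx ler10.
  + by move: (le_trans a1 b2); rewrite !eqxx ler10.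
Qed.

Lemma interval_intersection_exists (R : realType) (V : finType) (G : sgraph V) :
  exists k, `[< interval_intersection R G k >].
Proof.
pose N := [set p : V * V | (p.1 != p.2) && ~~ G p.1 p.2]%SET.
exists #|N|; apply/asboolP.
exists (fun i => copair_graph (enum_val i)); split=> [i|u v nuv].
  by apply: copair_interval; have := enum_valP i; rewrite inE => /andP[].
split=> [Guv i|h].
  have := enum_valP i; rewrite inE /= => /andP[_ nG].
  rewrite /copair_graph /copair_rel /= nuv /=.
  by apply/andP; split; apply: contra nG => /eqP <- //=; rewrite adj_sym.
apply/negPn/negP => nG.
have uvN : (u, v) \in N by rewrite inE /= nuv.
by have := h (enum_rank_in uvN (u, v));
  rewrite enum_rankK_in // /copair_graph /copair_rel /= eqxx andbF.
Qed.

Definition boxicity (R : realType) (V : finType) (G : sgraph V) : nat :=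
  ex_minn (interval_intersection_exists R G).

(* Main.v *)
Require Import Defs.
From mathcomp Require Import all_boot all_order all_algebra zify ring.

(* A graph without a K_(n+1) minor is decomposed recursively.  Given a connected
   set S of remaining vertices, the earlier pieces adjacent to S are pairwise
   adjacent, so there are fewer than n of them, and one of n colours is free
   for the next piece H: a union of geodesics of G[S] from a root r to
   neighbours of those earlier pieces.  Then the recursion continues with the
   components of S minus H.  The pieces are the nodes of a forest, every edge
   joins comparable nodes, and no vertex has neighbours in two nodes of the
   same colour above it.

   The n colours, the n geodesics of each piece and the parity of the distance
   to r cut the vertices into 2n^2 classes, with distances to r distinct
   within a class of one node.  For each class take two interval graphs, coming
   from two depth-first traversals that visit siblings in opposite orders and
   the vertices of a geodesic in opposite directions: class vertices are
   points, and the interval of any other v goes from its first class neighbour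
   above it to the end of its subtree.  One of the two orders separates
   vertices in incomparable nodes.  The class neighbours of v in a node above v
   have distances to r of equal parity differing by at most 2, so no other class
   vertex of that node lies beyond the first of them in both directions.  Hence
   the boxicity is at most 4n^2, which even saves the logarithm. *)

Set Implicit Arguments.
Unset Strict Implicit.
Unset Printing Implicit Defensive.

(** * Connected sets and geodesics *)

Section Connectivity.
Variables (V : finType) (G : sgraph V).
Implicit Types (B S P : {set V}) (r u v : V).

Definition rel_in B : rel V := [rel u v in B | G u v].

Lemma rel_in_sym B : symmetric (rel_in B).
Proof. by move=> u v; rewrite /rel_in /= adj_sym [(u \in B) && _]andbC. Qed.

Lemma connect_rel_inC B u v : connect (rel_in B) u v = connect (rel_in B) v u.
Proof. exact/sym_connect_sym/rel_in_sym. Qed.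

Lemma connect_rel_inS B S u v :
  B \subset S -> connect (rel_in B) u v -> connect (rel_in S) u v.
Proof.
move=> /subsetP sBS; apply: connect_sub => x y /= /andP[/andP[xB yB] Gxy].
by apply: connect1; rewrite /rel_in /= !sBS.
Qed.

Lemma connected_in_root B r :
  {in B, forall v, connect (rel_in B) r v} -> connected_in G B.
Proof.
move=> h x y xB yB; apply: (connect_trans (y := r)); last exact: h.
by rewrite connect_rel_inC h.
Qed.

Lemma connected_in_bigcup (I : finType) (F : I -> {set V}) r :
  (forall i, r \in F i) -> (forall i, connected_in G (F i)) ->
  connected_in G (\bigcup_i F i).
Proof.
move=> rF cF; apply: (@connected_in_root _ r) => v /bigcupP[i _ vF].
by apply: (connect_rel_inS (bigcup_sup i _)) => //; apply: cF.
Qed.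

(** Breadth-first search from [r] inside [S]: [d] is the distance from [r] in the graph induced on
    [S], and [P] is a shortest path, which meets each distance level at most once. *)
Lemma geodesics S r :
  r \in S -> {in S, forall v, connect (rel_in S) r v} ->
  exists d : V -> nat,
    {in S &, forall u v, G u v -> d u <= (d v).+1} /\
    {in S, forall v, exists P : {set V}, [/\ r \in P, v \in P, P \subset S,
                                 connected_in G P & {in P &, injective d}]}.
Proof.
move=> rS cS.
pose step (X : {set V}) := X :|: [set v in S | [exists u in X, G u v]].
pose ball n := iter n step [set r].
have ballS n : ball n \subset S.
  elim: n => [|n IH] /=; first by rewrite sub1set.
  by rewrite subUset IH; apply/subsetP => v; rewrite inE => /andP[].
have ball_step n u v : u \in ball n -> v \in S -> G u v -> v \in ball n.+1.
  move=> un vS Guv; rewrite /= !inE vS; apply/orP; right.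
  by apply/existsP; exists u; rewrite un.
have reach v : v \in S -> exists n, v \in ball n.
  move=> vS; have /connectP[p] := cS v vS.
  have : r \in ball 0 by rewrite /= inE.
  elim: p (r) 0 => [|w p IH] x n xn /=; first by move=> _ ->; exists n.
  move=> /andP[/andP[/andP[_ wS] Gxw] pth] lst.
  exact: (IH w n.+1 (ball_step _ _ _ xn wS Gxw)).
have [v|d dP] := fin_all_exists (P := fun v (n : nat) =>
    v \in S -> v \in ball n /\ forall m, v \in ball m -> n <= m).
  case: (boolP (v \in S)) => [vS|_]; last by exists 0.
  by case: (ex_minnP (reach v vS)) => n vn nmin; exists n.
have dLip : {in S &, forall u v, G u v -> d u <= (d v).+1}.
  move=> u v uS vS Guv; apply: (dP u uS).2; apply: (ball_step _ v) => //.
    exact: (dP v vS).1.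
  by rewrite adj_sym.
exists d; split=> // v vS.
(* The bound on [d] over [P] preserves injectivity when the next vertex is added one level further
   out. *)
suff [P hP _] : exists2 P : {set V}, [/\ r \in P, v \in P, P \subset S,
    connected_in G P & {in P &, injective d}] & {in P, forall x, d x <= d v}.
  by exists P.
move: {2}(d v) (erefl (d v)) => n; elim: n v vS => [|n IH] v vS dv.
  have := (dP v vS).1; rewrite dv /= inE => /eqP vr.
  exists [set r]; last by move=> x /set1P ->; rewrite -vr dv.
  rewrite !inE vr sub1set; split=> //.
  - by move=> x y /set1P-> /set1P->; apply: connect0.
  - by move=> x y /set1P-> /set1P->.
have [vn vmin] := dP v vS; rewrite dv /= in_setU in vn.
case/orP: vn => [/vmin|]; first by rewrite dv ltnn.
rewrite inE => /andP[_ /existsP[u /andP[un Guv]]].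
have uS := subsetP (ballS n) u un.
have du : d u = n.
  have := (dP u uS).2 n un.
  have : d v <= (d u).+1 by apply: dLip => //; rewrite adj_sym.
  by rewrite dv; lia.
have [P [rP uP PS cP injP] dPu] := IH u uS du.
exists (v |: P); last first.
  move=> x; rewrite !inE => /orP[/eqP->|xP] //.
  by rewrite (leq_trans (dPu x xP)) // du dv.
rewrite !inE eqxx rP orbT subUset sub1set vS PS; split=> //.
- apply: (@connected_in_root _ u) => x; rewrite !inE => /orP[/eqP->|xP].
    by apply: connect1; rewrite /rel_in /= !inE eqxx uP orbT.
  by apply: (connect_rel_inS (subsetUr _ _)); apply: cP.
- move=> x y; rewrite !inE => /orP[/eqP->|xP] /orP[/eqP->|yP] //; last exact: injP.
  + by move=> e; have := dPu y yP; rewrite -e dv du ltnn.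
  + by move=> e; have := dPu x xP; rewrite e dv du ltnn.
Qed.

End Connectivity.

(* The vertices are partitioned into the nodes of a forest: [anc u v] means that
   the node of [u] is that of [v] or an ancestor of it, so [u] and [v] are in the
   same node when [anc u v && anc v u].  [enter k v] and [leave k v] bound the
   subtree of the node of [v] in the [k]-th depth-first traversal, and [depth v]
   is the distance from the root vertex of the node. *)
Record layout_data (V : finType) (n : nat) := LayoutData {
  color : V -> 'I_n;
  in_path : V -> {set 'I_n};
  depth : V -> nat;
  anc : rel V;
  enter : bool -> V -> nat;
  leave : bool -> V -> nat }.

(* [B i] is the only node of colour [i] outside [S] which may be adjacent to
   [S]; it is empty if there is none. *)
Record is_layout (V : finType) (G : sgraph V) (n : nat) (S : {set V})
    (B : 'I_n -> {set V}) (L : layout_data V n) : Prop := IsLayout {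
  anc_refl : {in S, forall v, anc L v v};
  anc_enter : {in S &, forall u v k,
    anc L u v = (enter L k u <= enter L k v <= leave L k u)};
  anc_leave : {in S &, forall u v k, anc L u v -> leave L k v <= leave L k u};
  incomparable_enter : {in S &, forall u v, ~~ anc L u v -> ~~ anc L v u ->
    enter L true u < enter L true v -> enter L false v < enter L false u};
  adj_anc : {in S &, forall u v, G u v -> anc L u v || anc L v u};
  color_separates : {in S & &, forall u v w, color L u = color L v ->
    anc L u v -> ~~ anc L v u -> anc L v w -> ~~ G u w};
  color_outer : {in S &, forall v w, anc L v w ->
    {in B (color L v), forall b, ~~ G b w}};
  in_some_path : {in S, forall v, exists p, p \in in_path L v};
  depth_inj : {in S &, forall u v p, anc L u v -> anc L v u ->
    p \in in_path L u -> p \in in_path L v -> depth L u = depth L v -> u = v};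
  depth_adj : {in S &, forall u v, anc L u v -> anc L v u -> G u v ->
    depth L u <= (depth L v).+1};
  depth_adj2 : {in S & &, forall u v w, anc L u v -> anc L v u -> anc L u w ->
    G u w -> G v w -> depth L u <= (depth L v).+2} }.

(** * Existence of layouts in the absence of a complete minor *)

Section LayoutExistence.
Variables (V : finType) (G : sgraph V) (n : nat).
Implicit Types (S : {set V}) (B : 'I_n -> {set V}) (L : layout_data V n).

(** The non-empty [B i] are branch sets of a complete minor outside [S]; an empty one marks a free
    colour. *)
Record is_context S B : Prop := IsContext {
  context_connected : forall i, connected_in G (B i);
  context_disjoint : forall i j, i != j -> [disjoint B i & B j];
  context_adj : forall i j, i != j -> B i != set0 -> B j != set0 ->
    exists u v, [/\ u \in B i, v \in B j & G u v];
  context_outer : forall i, [disjoint B i & S] }.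

Lemma context_sub S S' B : S' \subset S -> is_context S B -> is_context S' B.
Proof.
move=> sS [c d a o]; split=> // i.
by rewrite disjoint_sym (disjointWl sS) // disjoint_sym.
Qed.

Lemma layout0 B (i : 'I_n) : exists L, is_layout G set0 B L.
Proof.
exists (LayoutData (fun=> i) (fun=> set0) (fun=> 0) (fun _ _ => true)
          (fun _ _ => 0) (fun _ _ => 0)).
by split=> u; rewrite inE.
Qed.

Lemma layoutU (S1 S2 : {set V}) B L1 L2 :
  [disjoint S1 & S2] -> {in S1 & S2, forall u v, ~~ G u v} ->
  is_layout G S1 B L1 -> is_layout G S2 B L2 ->
  exists L, is_layout G (S1 :|: S2) B L.
Proof.
move=> dS nG H1 H2.
pose N := (\max_(v in S1) maxn (leave L1 true v) (leave L1 false v)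
          + \max_(v in S2) maxn (leave L2 true v) (leave L2 false v)).+1.
have b1 k v : v \in S1 -> leave L1 k v < N.
  move=> vS; rewrite ltnS; apply: leq_trans (leq_addr _ _).
  apply: leq_trans (leq_bigmax_cond _ vS); case: k; lia.
have b2 k v : v \in S2 -> leave L2 k v < N.
  move=> vS; rewrite ltnS; apply: leq_trans (leq_addl _ _).
  apply: leq_trans (leq_bigmax_cond _ vS); case: k; lia.
pose c u := u \in S1.
pose sel T (x y : V -> T) u := if c u then x u else y u.
(* [S1] comes first in the traversal [true] and [S2] in the traversal [false], so vertices from
   different sides are visited in opposite orders. *)
pose shift k u := if c u == k then 0 else N.
exists (LayoutData (sel _ (color L1) (color L2))
  (sel _ (in_path L1) (in_path L2)) (sel _ (depth L1) (depth L2))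
  (fun u v => (c u == c v) && (if c u then anc L1 u v else anc L2 u v))
  (fun k u => shift k u + sel _ (enter L1 k) (enter L2 k) u)
  (fun k u => shift k u + sel _ (leave L1 k) (leave L2 k) u)).
have cP u : u \in S1 :|: S2 -> (c u /\ u \in S1) \/ (c u = false /\ u \in S2).
  rewrite inE /c; case: (u \in S1) => /=; first by left.
  by right.
have e1 k v : v \in S1 -> enter L1 k v <= leave L1 k v.
  by move=> vS; have := anc_refl H1 vS; rewrite (anc_enter H1 vS vS k) => /andP[].
have e2 k v : v \in S2 -> enter L2 k v <= leave L2 k v.
  by move=> vS; have := anc_refl H2 vS; rewrite (anc_enter H2 vS vS k) => /andP[].
split=> /=; rewrite /shift /sel /=.
- move=> v /cP[] [-> vS]; rewrite ?eqxx /=; first exact: (anc_refl H1).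
  exact: (anc_refl H2).
- move=> u v /cP[] [cu uS] /cP[] [cv vS] k; rewrite !cu !cv /=.
  + by rewrite (anc_enter H1 uS vS k) !leq_add2l.
  + have := b1 k u uS; have := b2 k v vS; have := e2 k v vS; have := e1 k u uS.
    by case: (k) => /=; lia.
  + have := b2 k u uS; have := b1 k v vS; have := e1 k v vS; have := e2 k u uS.
    by case: (k) => /=; lia.
  + by rewrite (anc_enter H2 uS vS k) !leq_add2l.
- move=> u v /cP[] [cu uS] /cP[] [cv vS] k; rewrite !cu !cv //= leq_add2l.
    exact: (anc_leave H1).
  exact: (anc_leave H2).
- move=> u v /cP[] [cu uS] /cP[] [cv vS]; rewrite !cu !cv //=.
  + by rewrite !ltn_add2l; apply: (incomparable_enter H1).
  + have := b1 false u uS; have := b2 false v vS; have := e2 false v vS.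
    by have := e1 false u uS; lia.
  + have := b2 true u uS; have := b1 true v vS; have := e1 true v vS.
    by have := e2 true u uS; lia.
  + by rewrite !ltn_add2l; apply: (incomparable_enter H2).
- move=> u v /cP[] [cu uS] /cP[] [cv vS]; rewrite !cu !cv //=.
  + exact: (adj_anc H1).
  + by rewrite (negbTE (nG u v uS vS)).
  + by rewrite adj_sym (negbTE (nG v u vS uS)).
  + exact: (adj_anc H2).
- move=> u v w /cP[] [cu uS] /cP[] [cv vS] /cP[] [cw wS]; rewrite !cu !cv ?cw //=.
    exact: (color_separates H1).
  exact: (color_separates H2).
- move=> v w /cP[] [cv vS] /cP[] [cw wS]; rewrite !cv ?cw //=.
    exact: (color_outer H1).
  exact: (color_outer H2).
- move=> v /cP[] [-> vS]; [exact: (in_some_path H1)|exact: (in_some_path H2)].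
- move=> u v /cP[] [cu uS] /cP[] [cv vS] p; rewrite !cu !cv //=.
    exact: (depth_inj H1).
  exact: (depth_inj H2).
- move=> u v /cP[] [cu uS] /cP[] [cv vS]; rewrite !cu !cv //=.
    exact: (depth_adj H1).
  exact: (depth_adj H2).
- move=> u v w /cP[] [cu uS] /cP[] [cv vS] /cP[] [cw wS]; rewrite !cu !cv ?cw //=.
    exact: (depth_adj2 H1).
  exact: (depth_adj2 H2).
Qed.

(** Only [color_outer] mentions the outer sets, and only through their edges into [S]. *)
Lemma layout_outer S B B' L :
  (forall i, {in B i & S, forall b w, G b w -> b \in B' i}) ->
  is_layout G S B' L -> is_layout G S B L.
Proof.
move=> hB [h1 h2 h3 h4 h5 h6 h7 h8 h9 h10 h11]; split=> // v w vS wS vw b bB.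
apply/negP => Gbw; move/negP: (h7 v w vS wS vw b (hB _ b w bB wS Gbw)).
exact.
Qed.

(** [H] becomes the root node above a layout of the rest. Passing [H] to that layout as the outer
    set of colour [i0] turns its [color_outer] into [color_separates] between [H] and the deeper
    nodes of this colour. *)
Lemma layout_top S B (P : 'I_n -> {set V}) (d : V -> nat) (i0 : 'I_n) L :
  let H := \bigcup_i P i in
  H \subset S -> B i0 = set0 ->
  {in S &, forall u v, G u v -> d u <= (d v).+1} ->
  (forall i, {in P i &, injective d}) ->
  is_layout G (S :\: H) (fun i => if i == i0 then H else B i) L ->
  exists L', is_layout G S B L'.
Proof.
move=> H /subsetP HS B0 dLip dinj HL.
pose N := (\max_v maxn (leave L true v) (leave L false v)).+1.
have bN k v : leave L k v < N.
  rewrite ltnS; apply: leq_trans (leq_bigmax v); case: k; lia.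
pose c u := u \in H.
pose sel T (x y : V -> T) u := if c u then x u else y u.
exists (LayoutData (sel _ (fun=> i0) (color L))
  (sel _ (fun u => [set i | u \in P i]) (in_path L)) (sel _ d (depth L))
  (fun u v => c u || ~~ c v && anc L u v)
  (fun k => sel _ (fun=> 0) (fun u => (enter L k u).+1))
  (fun k => sel _ (fun=> N) (fun u => (leave L k u).+1))).
have cP u : u \in S -> (c u /\ u \in H) \/ (c u = false /\ u \in S :\: H).
  by rewrite inE /c; case: (u \in H) => /= uS; [left|right].
split=> /=; rewrite /sel.
- move=> v vS; case: (cP v vS) => -[-> vH] //=.
  exact: (anc_refl HL).
- move=> u v uS vS k; case: (cP u uS) => -[-> uH]; case: (cP v vS) => -[-> vH] //=.
    have := anc_refl HL vH; rewrite (anc_enter HL vH vH k) => /andP[_ ev].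
    by rewrite (leq_ltn_trans ev (bN k v)).
  exact: (anc_enter HL).
- move=> u v uS vS k; case: (cP u uS) => -[-> uH]; case: (cP v vS) => -[-> vH] //=.
  exact: (anc_leave HL).
- move=> u v uS vS; case: (cP u uS) => -[-> uH]; case: (cP v vS) => -[-> vH] //=.
  exact: (incomparable_enter HL).
- move=> u v uS vS; case: (cP u uS) => -[-> uH]; case: (cP v vS) => -[-> vH] //=.
  exact: (adj_anc HL).
- move=> u v w uS vS wS; case: (cP u uS) => -[-> uH];
    case: (cP v vS) => -[-> vH] //=; case: (cP w wS) => -[-> wH] //=.
    move=> ci _ _ vw; apply: (color_outer HL vH wH vw).
    by rewrite -ci eqxx.
  exact: (color_separates HL).
- move=> v w vS wS; case: (cP v vS) => -[-> vH] /=.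
    by move=> _ b; rewrite B0 inE.
  case: (cP w wS) => -[-> wH] //= vw b bB.
  apply: (color_outer HL vH wH vw); case: eqP => // ci.
  by rewrite ci B0 inE in bB.
- move=> v vS; case: (cP v vS) => -[-> vH].
    by case/bigcupP: vH => i _ vP; exists i; rewrite inE.
  exact: (in_some_path HL).
- move=> u v uS vS p; case: (cP u uS) => -[-> uH]; case: (cP v vS) => -[-> vH] //=.
    by move=> _ _; rewrite !inE; apply: dinj.
  exact: (depth_inj HL).
- move=> u v uS vS; case: (cP u uS) => -[-> uH]; case: (cP v vS) => -[-> vH] //=.
    by move=> _ _; apply: dLip.
  exact: (depth_adj HL).
- move=> u v w uS vS wS; case: (cP u uS) => -[-> uH]; case: (cP v vS) => -[-> vH] //=.
    (* The common neighbour [w] may lie below the root node, so the Lipschitz bound on [d] is needed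
       on all of [S], not only on [H]. *)
    move=> _ _ _ Guw Gvw; apply: leq_trans (dLip _ _ uS wS Guw) _.
    by rewrite ltnS dLip // adj_sym.
  by case: (cP w wS) => -[-> wH] //=; apply: (depth_adj2 HL).
Qed.

(** Dropping the sets without a neighbour in [S] frees their colours. *)
Lemma context_restrict S B :
  is_context S B -> is_context S (fun i =>
    if [exists b in B i, exists w in S, G b w] then B i else set0).
Proof.
move=> [c d a o]; split=> [i|i j ij|i j ij|i].
- by case: ifP => _ //; move=> x y; rewrite inE.
- have := d i j ij; rewrite -!setI_eq0.
  by do 2!case: ifP => _; rewrite ?set0I ?setI0 ?eqxx.
- by do 2!case: ifP => _; rewrite ?eqxx //; apply: a.
- by case: ifP => _ //; rewrite disjoints_subset sub0set.
Qed.

(** When all [n] colours are taken, [S] itself is the missing branch set. *)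
Lemma minor_of_context S B :
  is_context S B -> S != set0 -> connected_in G S ->
  (forall i, exists2 b, b \in B i & exists2 w, w \in S & G b w) ->
  minor (complete_graph n.+1) G.
Proof.
move=> [c d a o] S0 cS adjS.
have B0 i : B i != set0 by case: (adjS i) => b bB _; apply/set0Pn; exists b.
exists (fun x => if unlift ord0 x is Some i then B i else S); split=> [x|x|x y|x y].
- by case: unlift.
- by case: unlift.
- case: (unliftP ord0 x) => [i|] ->; case: (unliftP ord0 y) => [j|] -> //=.
  + by rewrite (inj_eq lift_inj); apply: d.
  + by rewrite disjoint_sym.
- rewrite /=; case: (unliftP ord0 x) => [i|] ->; case: (unliftP ord0 y) => [j|] ->.
  + by rewrite (inj_eq lift_inj) => ij; apply: a.
  + by move=> _; case: (adjS i) => b bB [w wS Gbw]; exists b, w.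
  + move=> _; case: (adjS j) => b bB [w wS Gbw]; exists w, b.
    by rewrite adj_sym.
  + by rewrite eqxx.
Qed.

(* The geodesics from [r] to neighbours of the sets [B i] form the top node. *)
Lemma layout_exists S B :
  0 < n -> ~ minor (complete_graph n.+1) G -> is_context S B ->
  exists L, is_layout G S B L.
Proof.
move=> n0 nM; have [m] := ubnP #|S|; elim: m S B => // m IH S B.
rewrite ltnS => Sm ctx.
case: (set_0Vmem S) => [->|[r rS]]; first exact: (layout0 B (Ordinal n0)).
pose C := [set v in S | connect (rel_in G S) r v].
have sC : C \subset S by apply/subsetP => v; rewrite inE => /andP[].
have rC : r \in C by rewrite inE rS connect0.
(* A disconnected [S] splits into the component of [r] and the rest, both smaller and with no edge
   between them. *)
have [CS|CS] := eqVneq C S; last first.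
  have CD : C :|: S :\: C = S.
    by apply/setP => v; rewrite !inE; case: (v \in S); case: connect.
  have pC : C \proper S by rewrite properEneq CS.
  have [L1 H1] : exists L, is_layout G C B L.
    by apply: IH; [apply: leq_trans (proper_card pC) _|apply: context_sub sC ctx].
  have [L2 H2] : exists L, is_layout G (S :\: C) B L.
    apply: IH; last by apply: context_sub ctx; rewrite subsetDl.
    apply: leq_trans Sm; apply: proper_card; rewrite properEneq subsetDl andbT.
    by apply/eqP => /setP/(_ r); rewrite in_setD rS rC.
  rewrite -CD; apply: layoutU H1 H2.
    by rewrite disjoints_subset; apply/subsetP => v; rewrite !inE negb_and negbK => ->.
  move=> u v; rewrite !inE => /andP[uS ru] /andP[nrv vS]; apply: contra nrv => Guv.
  rewrite vS (connect_trans ru) //; apply: connect1.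
  by rewrite /rel_in /= uS vS.
have cS : {in S, forall v, connect (rel_in G S) r v}.
  by move=> v vS; have : v \in C by [rewrite CS]; rewrite inE => /andP[].
pose B' i := if [exists b in B i, exists w in S, G b w] then B i else set0.
have [c' d' a' o'] : is_context S B' by apply: context_restrict.
suff [L HL] : exists L, is_layout G S B' L.
  exists L; apply: layout_outer HL => i b w bB wS Gbw; rewrite /B'.
  by rewrite ifT //; apply/exists_inP; exists b => //; apply/exists_inP; exists w.
have B'adj i : B' i != set0 -> exists2 b, b \in B' i & exists2 w, w \in S & G b w.
  rewrite /B'; case: ifP => [/exists_inP[b bB /exists_inP[w wS Gbw]] _|]; last first.
    by rewrite eqxx.
  by exists b => //; exists w.
have [i0 Bi0] : exists i0, B' i0 = set0.
  case: (pickP (fun i => B' i == set0)) => [i /eqP|nB]; first by exists i.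
  case: nM; apply: (@minor_of_context S B') => // [||i].
  - by apply/set0Pn; exists r.
  - exact: connected_in_root cS.
  - by apply: B'adj; rewrite nB.
have [d [dLip geo]] := geodesics rS cS.
have /fin_all_exists[P PP] : forall i, exists P : {set V},
    [/\ r \in P, P \subset S, connected_in G P, {in P &, injective d}
      & B' i != set0 -> exists2 w, w \in P & exists2 b, b \in B' i & G b w].
  move=> i.
  have [Bi|Bi] := eqVneq (B' i) set0.
    have [P [h1 h2 h3 h4 h5]] := geo r rS.
    by exists P; split=> //; rewrite Bi eqxx.
  have [b bB [w wS Gbw]] := B'adj i Bi.
  have [P [h1 h2 h3 h4 h5]] := geo w wS.
  by exists P; split=> // _; exists w => //; exists b.
pose H := \bigcup_i P i.
have HS : H \subset S by apply/bigcupsP => i _; case: (PP i).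
have PH i : P i \subset H by apply: bigcup_sup.
have rH : r \in H by apply: (subsetP (PH i0)); case: (PP i0).
(* [H] takes the free colour: it is connected since all the geodesics contain [r], and the [j]-th
   one makes it adjacent to [B' j] if that set is non-empty. *)
have [L HL] : exists L, is_layout G (S :\: H) (fun i => if i == i0 then H else B' i) L.
  apply: IH.
    apply: leq_trans Sm; apply: proper_card; rewrite properEneq subsetDl andbT.
    by apply/eqP => /setP/(_ r); rewrite in_setD rS rH.
  have HB j : j != i0 -> [disjoint H & B' j].
    by move=> _; rewrite disjoint_sym; apply: disjointWr HS (o' j).
  have aH j : j != i0 -> B' j != set0 -> exists u v, [/\ u \in H, v \in B' j & G u v].
    move=> _ Bj; case: (PP j) => _ _ _ _ /(_ Bj)[w wP [b bB Gbw]].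
    by exists w, b; rewrite adj_sym (subsetP (PH j)).
  split=> [i|i j|i j|i].
  - case: eqP => // _; apply: (@connected_in_bigcup _ _ _ _ r) => j; by case: (PP j).
  - case: (eqVneq i i0) => [->|ni]; case: (eqVneq j i0) => [_ //|nj].
    + by move=> _; apply: HB.
    + by move=> _; rewrite disjoint_sym; apply: HB.
    + exact: d'.
  - case: (eqVneq i i0) => [->|ni]; case: (eqVneq j i0) => [_ //|nj].
    + by move=> _ _; apply: aH.
    + move=> _ Bi _; case: (aH i ni Bi) => u [v [uH vB Guv]].
      by exists v, u; rewrite adj_sym.
    + exact: a'.
  - case: eqP => _; last by apply: disjointWr (o' i); apply: subsetDl.
    rewrite disjoint_sym disjoints_subset; apply/subsetP => v.
    by rewrite !inE => /andP[].
apply: (layout_top HS Bi0 dLip _ HL) => i; by case: (PP i).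
Qed.

End LayoutExistence.

(** * Interval representations from a layout *)

Lemma ltn_odd_eq a b : odd a = odd b -> a < b -> a.+1 < b.
Proof.
move=> oab; rewrite leq_eqVlt => /orP[/eqP ba|//].
by move: oab; rewrite -ba /=; case: odd.
Qed.

Lemma exists_min (T : finType) (F : pred T) (f : T -> nat) m0 :
  exists m, [/\ m <= m0, forall u, F u -> m <= f u
              & m = m0 \/ exists2 u, F u & m = f u].
Proof.
case: (pickP F) => [u0 Fu0|F0]; last first.
  by exists m0; split=> // [u|]; [rewrite F0|left].
case: (arg_minnP f Fu0) => u Fu umin.
case: (leqP (f u) m0) => hu; first by exists (f u); split=> //; right; exists u.
exists m0; split=> // [v Fv|]; last by left.
exact: leq_trans (ltnW hu) (umin v Fv).
Qed.

Section LayoutIntervals.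
Variables (V : finType) (G : sgraph V) (n : nat) (L : layout_data V n).
Hypothesis HL : is_layout G setT (fun=> set0) L.

Local Notation anc := (anc L).
Local Notation enter := (enter L).
Local Notation leave := (leave L).
Local Notation color := (color L).
Local Notation depth := (depth L).

Let inT (v : V) : v \in setT. Proof. by rewrite inE. Qed.

Lemma anc_trans u v w : anc u v -> anc v w -> anc u w.
Proof.
move=> uv vw; have := anc_leave HL (inT u) (inT v) true uv.
move: uv vw; rewrite !(anc_enter HL (inT _) (inT _) true); lia.
Qed.

Lemma anc_total u v w : anc u w -> anc v w -> anc u v || anc v u.
Proof. by rewrite !(anc_enter HL (inT _) (inT _) true); lia. Qed.

Lemma enter_leave k v : enter k v <= leave k v.
Proof.
have := anc_refl HL (inT v).
by rewrite (anc_enter HL (inT _) (inT _) k) => /andP[].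
Qed.

Lemma enter_anc k u v : enter k u = enter k v -> anc u v.
Proof.
by move=> e; rewrite (anc_enter HL (inT _) (inT _) k) -e leqnn enter_leave.
Qed.

Lemma anc_eq_enter k u v : anc u v -> anc v u -> enter k u = enter k v.
Proof. rewrite !(anc_enter HL (inT _) (inT _) k); lia. Qed.

Lemma anc_lt_enter k u v : anc u v -> ~~ anc v u -> enter k u < enter k v.
Proof.
move=> uv; apply: contraR; rewrite -leqNgt => h; apply: (@enter_anc k).
move: uv; rewrite (anc_enter HL (inT _) (inT _) k); lia.
Qed.

Lemma same_color_adj u v w :
  color u = color v -> anc u v -> anc v w -> G u w -> anc v u.
Proof.
move=> cuv uv vw; apply: contraLR => nvu.
exact: (color_separates HL (inT u) (inT v) (inT w) cuv uv nvu vw).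
Qed.

(** The opposite orders make [u] enter after [v] in one of the traversals; as [u] is not below [v],
    it then enters after the whole subtree of [v]. *)
Lemma incomparable_leave u v : ~~ anc u v -> ~~ anc v u ->
  (leave true v < enter true u) || (leave false v < enter false u).
Proof.
move=> nuv nvu; have := incomparable_enter HL (inT u) (inT v) nuv nvu.
have := enter_leave true v; have := enter_leave false v.
have := nvu; rewrite (anc_enter HL (inT _) (inT _) true).
have := nvu; rewrite (anc_enter HL (inT _) (inT _) false); lia.
Qed.

(* [x] consists of a colour, a path, a parity of the depth and a traversal.  The
   [M] consecutive integers from [enter k v * M] on belong to the node of [v]:
   the last one, [top (enter k v)], lies in the interval of every vertex of the
   node outside the class, so that these intervals intersect. *)
Lemma layout_intervals :
  exists a b : 'I_n * 'I_n * bool * bool -> V -> nat,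
    (forall x v, a x v <= b x v) /\
    forall u v, u != v ->
      G u v = [forall x, (a x u <= b x v) && (a x v <= b x u)].
Proof.
(* Depths are at most [M - 2], so the offset [M - 1] in each block stays free for [top]. *)
pose M := (\max_v depth v).+2.
have dM v : depth v <= M.-2 by rewrite /M /= leq_bigmax.
pose cls (x : 'I_n * 'I_n * bool * bool) v :=
  [&& color v == x.1.1.1, x.1.1.2 \in in_path L v & odd (depth v) == x.1.2].
pose pos k v := enter k v * M + (if k then depth v else M.-2 - depth v).
pose top m := m * M + M.-1.
have pos_top k u m : enter k u <= m -> pos k u < top m.
  move=> h; have := leq_mul h (leqnn M); rewrite /pos /top.
  by have := dM u; case: (k); lia.
have top_pos k u m : m < enter k u -> top m < pos k u.
  move=> h; have := leq_mul h (leqnn M); rewrite /pos /top mulSn.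
  by have := dM u; case: (k); lia.
have top_mono m m' : m <= m' -> top m <= top m'.
  move=> h; have := leq_mul h (leqnn M); rewrite /top; lia.
(* The default, the top of the node of [v], is taken only if [v] has no class neighbour above it or
   in its node: any such neighbour comes before that top. *)
have [low lowP] := fin_all_exists (fun y : ('I_n * 'I_n * bool * bool) * V =>
  exists_min (fun u => [&& cls y.1 u, G u y.2 & anc u y.2]) (pos y.1.2)
             (top (enter y.1.2 y.2))).
exists (fun x v => if cls x v then pos x.2 v else low (x, v)),
  (fun x v => if cls x v then pos x.2 v else top (leave x.2 v)).
have low_top x v : low (x, v) <= top (enter x.2 v).
  by case: (lowP (x, v)).
split=> [x v|u v nuv].
  case: ifP => _ //; apply: leq_trans (low_top _ _) _.
  exact/top_mono/enter_leave.
apply/idP/forallP => [Guv x|sep].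
- wlog uv : u v nuv Guv / anc u v.
    move=> hw; case/orP: (adj_anc HL (inT u) (inT v) Guv) => [uv|vu]; first exact: hw.
    by rewrite andbC; apply: hw => //; rewrite 1?eq_sym // adj_sym.
  have [suv sle] : enter x.2 u <= enter x.2 v /\ enter x.2 v <= leave x.2 u.
    by move: uv; rewrite (anc_enter HL (inT _) (inT _) x.2) => /andP.
  have lv := anc_leave HL (inT u) (inT v) x.2 uv.
  have ev := enter_leave x.2 v; have eu := enter_leave x.2 u.
  case: ifP => cu; case: ifP => cv.
  (* Class vertices are never adjacent: equal colours force a common node, where adjacent vertices
     with depths of equal parity have equal depths and hence coincide. *)
  + case/and3P: (cu) => /eqP cu1 pu /eqP ou; case/and3P: (cv) => /eqP cv1 pv /eqP ov.
    have vu : anc v u.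
      by apply: (same_color_adj (w := v)); rewrite ?cu1 //; apply: (anc_refl HL).
    have d1 := depth_adj HL (inT u) (inT v) uv vu Guv.
    have d2 : depth v <= (depth u).+1.
      by apply: (depth_adj HL (inT v) (inT u)); rewrite 1?adj_sym.
    have duv : depth u = depth v.
      have ouv : odd (depth u) = odd (depth v) by rewrite ou ov.
      case: (ltngtP (depth u) (depth v)) => // h.
        by have := ltn_odd_eq ouv h; rewrite ltnNge d2.
      by have := ltn_odd_eq (esym ouv) h; rewrite ltnNge d1.
    by rewrite (depth_inj HL (inT u) (inT v) uv vu pu pv duv) eqxx in nuv.
  + apply/andP; split.
      by apply/ltnW/pos_top; apply: leq_trans ev.
    by case: (lowP (x, v)) => _ /(_ u) + _ /=; apply; rewrite cu Guv.
  + have [vu|nvu] := boolP (anc v u).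
      apply/andP; split; last exact/ltnW/pos_top.
      by case: (lowP (x, u)) => _ /(_ v) + _ /=; apply; rewrite cv adj_sym Guv.
    apply/andP; split; last exact/ltnW/pos_top.
    apply: leq_trans (low_top _ _) (ltnW _); apply: top_pos.
    exact: anc_lt_enter.
  + by rewrite !(leq_trans (low_top _ _)) // top_mono // (leq_trans suv).
- apply/negPn/negP => nG.
  wlog uv : u v nuv sep nG / anc u v \/ ~~ anc u v && ~~ anc v u.
    move=> hw; have [uv|nauv] := boolP (anc u v); first by apply: (hw u v) => //; left.
    have [vu|navu] := boolP (anc v u); last first.
      by apply: (hw u v) => //; right; rewrite nauv.
    apply: (hw v u) => //; [by rewrite eq_sym|by move=> x; rewrite andbC| |by left].
    by rewrite adj_sym.
  (* One class containing [u], taken in both traversals, suffices to separate [u] from [v]. *)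
  have [p up] := in_some_path HL (inT u).
  pose x (k : bool) := (color u, p, odd (depth u), k).
  have cu k : cls (x k) u by rewrite /cls /= !eqxx up.
  have pos_inj k w : cls (x k) w -> pos k u = pos k w -> u = w.
    case/and3P => /= _ pw _ e.
    have es : enter k u = enter k w.
      case: (ltngtP (enter k u) (enter k w)) => // /top_pos.
        by move/(ltn_trans (pos_top k u _ (leqnn _))); rewrite e ltnn.
      by move/(ltn_trans (pos_top k w _ (leqnn _))); rewrite e ltnn.
    apply: (depth_inj HL (inT u) (inT w)) up pw _; try by apply: (@enter_anc k).
    move/eqP: e; rewrite /pos es eqn_add2l; case: (k) => /eqP //.
    by rewrite -{2}(subKn (dM u)) -{2}(subKn (dM w)) => ->.
  have [cv|ncv] := boolP (cls (x true) v).
    have := sep (x true); rewrite cu cv -eqn_leq => /eqP /(pos_inj _ _ cv) e.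
    by rewrite e eqxx in nuv.
  have cvk k : cls (x k) v = false by apply: negbTE.
  have {}sep k : low (x k, v) <= pos k u <= top (leave k v).
    by have := sep (x k); rewrite cu cvk andbC.
  case: uv => [uv|/andP[nauv navu]]; last first.
    case/orP: (incomparable_leave nauv navu) => /top_pos; rewrite ltnNge.
      by case/andP: (sep true) => _ ->.
    by case/andP: (sep false) => _ ->.
  (* The interval of [v] reaches back to the point [u] only because of a class neighbour [w] of [v].
     Its position keeps [w] from being strictly below [u], and its colour from being strictly
     above. *)
  have nb k : exists w, [/\ cls (x k) w, G w v, anc w u, anc u w & pos k w <= pos k u].
    case: (lowP (x k, v)) => /= _ _ [e|[w /and3P[cw Gwv wv] e]].
      have /andP[+ _] := sep k; rewrite e leqNgt pos_top //.
      by move: uv; rewrite (anc_enter HL (inT _) (inT _) k) => /andP[].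
    have pwu : pos k w <= pos k u by rewrite -e; case/andP: (sep k).
    have ceq : color w = color u by case/and3P: cw => /eqP.
    exists w; split=> //; case/orP: (anc_total uv wv) => // h.
    + apply: contraLR pwu => nh; rewrite -ltnNge.
      exact: ltn_trans (pos_top k u _ (leqnn _)) (top_pos k w _ (anc_lt_enter k h nh)).
    + exact: (same_color_adj ceq h uv Gwv).
  have nbd k w : cls (x k) w -> G w v -> anc w u -> anc u w -> depth w != depth u.
    case/and3P => /= _ pw _ Gwv wu uw; apply: contra nG => /eqP dwu.
    by rewrite -(depth_inj HL (inT w) (inT u) wu uw pw up dwu).
  have [w1 [c1 G1 w1u uw1 p1]] := nb true.
  have [w2 [c2 G2 w2u uw2 p2]] := nb false.
  have n1 := nbd _ _ c1 G1 w1u uw1; have n2 := nbd _ _ c2 G2 w2u uw2.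
  have w12 := anc_trans w1u uw2; have w21 := anc_trans w2u uw1.
  have d21 := depth_adj2 HL (inT w2) (inT w1) (inT v) w21 w12 (anc_trans w2u uv) G2 G1.
  case/and3P: c1 => /= _ _ /eqP o1; case/and3P: c2 => /= _ _ /eqP o2.
  move: p1 p2; rewrite /pos (anc_eq_enter true w1u uw1) (anc_eq_enter false w2u uw2).
  rewrite !leq_add2l => p1 p2.
  (* By parity, [w1] is at least 2 levels before [u] and [w2] at least 2 after it, whereas
     neighbours of [v] in one node are at most 2 levels apart. *)
  have l1 : (depth w1).+1 < depth u by rewrite ltn_odd_eq // ltn_neqAle n1.
  have l2 : (depth u).+1 < depth w2.
    rewrite ltn_odd_eq // ltn_neqAle eq_sym n2 /=.
    by rewrite -(subKn (dM u)) -[depth w2](subKn (dM w2)) leq_sub2l.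
  by have := leq_ltn_trans l1 (ltnW l2); rewrite ltnNge d21.
Qed.

End LayoutIntervals.

(** * The boxicity bound *)

Lemma layout_setT (V : finType) (G : sgraph V) (n : nat) :
  0 < n -> ~ minor (complete_graph n.+1) G ->
  exists L : layout_data V n, is_layout G setT (fun=> set0) L.
Proof.
move=> n0 nM; apply: layout_exists => //; split=> [i|i j _|i j _|i].
- by move=> x y; rewrite inE.
- by rewrite -setI_eq0 set0I.
- by rewrite eqxx.
- by rewrite -setI_eq0 set0I.
Qed.

Definition overlap_rel (V : finType) (a b : V -> nat) : rel V :=
  [rel u v | [&& u != v, a u <= b v & a v <= b u]].

Lemma overlap_sym (V : finType) (a b : V -> nat) : symmetric (overlap_rel a b).
Proof. by move=> u v; rewrite /overlap_rel /= eq_sym [X in _ && X]andbC. Qed.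

Lemma overlap_irrefl (V : finType) (a b : V -> nat) :
  irreflexive (overlap_rel a b).
Proof. by move=> u; rewrite /overlap_rel /= eqxx. Qed.

Definition overlap_graph (V : finType) (a b : V -> nat) : sgraph V :=
  SGraph (overlap_sym a b) (overlap_irrefl a b).

From mathcomp Require Import all_classical all_reals all_analysis.
Import Order.TTheory GRing.Theory Num.Theory.
Local Open Scope ring_scope.

Lemma overlap_interval (R : realType) (V : finType) (a b : V -> nat) :
  (forall v, (a v <= b v)%N) -> interval_graph R (overlap_graph a b).
Proof.
move=> ab; exists (fun v => (a v)%:R), (fun v => (b v)%:R); split=> [v|u v nuv].
  by rewrite ler_nat.
rewrite /overlap_graph /overlap_rel /= nuv /=; split.
  move=> /andP[uv vu]; exists (maxn (a u) (a v))%:R => /=.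
  by rewrite !in_itv /= !ler_nat !geq_max leq_maxl leq_maxr !ab uv vu.
case=> z /=; rewrite !in_itv /= => -[/andP[a1 b1] /andP[a2 b2]].
by rewrite -!(ler_nat R) (le_trans a1 b2) (le_trans a2 b1).
Qed.

Lemma boxicity_le (R : realType) (V : finType) (G : sgraph V) (I : finType)
    (a b : I -> V -> nat) :
  (forall x v, (a x v <= b x v)%N) ->
  (forall u v, u != v ->
    G u v = [forall x, (a x u <= b x v)%N && (a x v <= b x u)%N]) ->
  (boxicity R G <= #|I|)%N.
Proof.
move=> ab GE; rewrite /boxicity; case: ex_minnP => m _; apply; apply/asboolP.
exists (fun i => overlap_graph (a (enum_val i)) (b (enum_val i))).
split=> [i|u v nuv]; first exact: overlap_interval.
rewrite GE //; split=> [/forallP h i|h]; first by rewrite /= /overlap_rel /= nuv h.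
apply/forallP => x; have := h (enum_rank x).
by rewrite /= /overlap_rel /= enum_rankK nuv.
Qed.

Lemma boxicity_minor_free (R : realType) (V : finType) (G : sgraph V) (n : nat) :
  (0 < n)%N -> ~ minor (complete_graph n.+1) G ->
  (boxicity R G <= 4 * n ^ 2)%N.
Proof.
move=> n0 nM; have [L HL] := layout_setT n0 nM.
have [a [b [ab GE]]] := layout_intervals HL.
apply: leq_trans (boxicity_le R ab GE) _.
(* The factor 4 counts two parities and two traversals. *)
by rewrite !card_prod card_ord card_bool; lia.
Qed.

Theorem theorem1 (R : realType) :
  exists C : R, 0 < C /\
    forall t : nat, (2 <= t)%N ->
    forall (V : finType) (G : sgraph V),
      ~ minor (complete_graph t) G ->
      (boxicity R G)%:R <= C * t%:R ^+ 2 * ln t%:R.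
Proof.
have ln2 : 0 < ln (2 : R) by rewrite ln_gt0 // ltr1n.
(* As [t >= 2], the factor [ln t / ln 2] is at least 1 and can be added to the bound without
   logarithm. *)
exists (4 / ln 2); split=> [|[|n] // n1 V G nM]; first by rewrite divr_gt0.
apply: (@le_trans _ _ (4 * n.+1%:R ^+ 2)).
  rewrite -natrX -natrM ler_nat; apply: leq_trans (boxicity_minor_free R n1 nM) _.
  by rewrite leq_mul2l leq_sqr leqnSn.
have -> : 4 / ln 2 * n.+1%:R ^+ 2 * ln n.+1%:R
        = 4 * n.+1%:R ^+ 2 * (ln n.+1%:R / ln 2) :> R.
  by ring.
rewrite ler_peMr ?mulr_ge0 ?exprn_ge0 // ler_pdivlMr // mul1r.
by rewrite ler_ln ?posrE ?ltr0n // ler_nat.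
Qed.
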